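(* Let $G$ be a hyperbolic group and let $U$ be a finite union of quasiconvex products of infinite index in $G$. Then $U$ is a proper subset of $G$, i.e. $G\neq U$.
   Context: A finitely generated group $G$ is hyperbolic if its Cayley graph $\Gamma(G,\mathcal{A})$ with respect to some (equivalently, any) finite symmetrized generating set $\mathcal{A}=\mathcal{A}^{-1}$ is a Gromov hyperbolic metric space. A subset $Q\subseteq G$ is $\varepsilon$-quasiconvex ($\varepsilon\ge 0$) if every geodesic in $\Gamma(G,\mathcal{A})$ connecting two elements of $Q$ lies in the closed $\varepsilon$-neighborhood of $Q$; $Q$ is quasiconvex if it is $\varepsilon$-quasiconvex for some $\varepsilon$ (for hyperbolic $G$ this does not depend on the choice of the finite generating set). A quasiconvex product is a set of the form $P=f_0G_1f_1G_2\cdots f_{n-1}G_nf_n=\{f_0g_1f_1\cdots g_nf_n\in G\mid g_i\in G_i,\ i=1,\dots,n\}$, where $n\in\mathbb{N}\cup\{0\}$, $G_1,\dots,G_n$ are quasiconvex subgroups of $G$ and $f_0,\dots,f_n\in G$; the subgroups $G_1,\dots,G_n$ are the members of $P$. A finite union of quasiconvex products is a set $U=\bigcup_{k=1}^q P_k$ with each $P_k$ a quasiconvex product; for any such $U$ a representation of this form is fixed, and a subgroup $H\le G$ is a member of $U$ if it is a member of $P_k$ for some $1\le k\le q$. A finite union of quasiconvex products has infinite index in $G$ if each of its members has infinite index in $G$.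
   Formalization: The group G is additionally assumed infinite: for finite G the claim fails, since G is the finite union of the memberless products {f_0}, which vacuously have infinite index. *)

(* Defs.v *)
From HB Require Import structures.
From mathcomp Require Import all_boot all_order all_algebra.
From mathcomp Require Import all_classical all_reals.

Set Implicit Arguments.
Unset Strict Implicit.
Unset Printing Implicit Defensive.

Import Order.TTheory GRing.Theory Num.Theory.

Local Open Scope classical_set_scope.
Local Open Scope ring_scope.

(** * Hyperbolicity, geodesics and quasiconvexity for a distance function *)

Section Metric.
Context {R : realType} {X : Type} (d : X -> X -> R).

Definition gromov_product (w x y : X) : R := (d x w + d y w - d x y) / 2.

Definition gromov_hyperbolic : Prop :=
  exists delta : R, 0 <= delta /\
    forall w x y z : X,
      Num.min (gromov_product w x y) (gromov_product w y z) - delta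
        <= gromov_product w x z.

Definition geodesic (x y : X) (L : R) (gamma : R -> X) : Prop :=
  [/\ 0 <= L, gamma 0 = x, gamma L = y &
      {in `[0, L] &, forall s t, d (gamma s) (gamma t) = `|s - t|}].

Definition set_dist (z : X) (Q : set X) : R := inf [set d z q | q in Q].

Definition quasiconvex_with (eps : R) (Q : set X) : Prop :=
  forall x y, Q x -> Q y ->
  forall L gamma, geodesic x y L gamma ->
  forall t, t \in `[0, L] -> set_dist (gamma t) Q <= eps.

End Metric.

(** * Geometric realization of a connected simple graph *)

Section Realization.
Context {R : realType} {V : eqType} (adj : rel V).

(** [Inner x y t] is the point at distance [t] from [x] on the edge joining
    [x] to [y].  It is the same point of the graph as [Inner y x (1 - t)]:
    the two are not identified, but are at distance [0] for [real_dist]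
    below. Every vertex has [Vertex] as its only representative. *)
Inductive realization : Type :=
| Vertex of V
| Inner (x y : V) (t : R) of adj x y & 0 < t < 1.

(** Connectedness makes the set of path lengths nonempty; on a disconnected
    graph the infimum would be a junk value. *)
Definition graph_dist (x y : V) : R :=
  inf [set (size s)%:R | s in [set s : seq V | path adj x s /\ last x s = y]].

(** The endpoints of the closed cell carrying [p], with their distances to
    [p]. *)
Definition ends (p : realization) : set (V * R) :=
  match p with
  | Vertex v => [set (v, 0)]
  | Inner x y t _ _ => [set (x, t); (y, 1 - t)]
  end.

Definition lies_on (p : realization) (x y : V) (t : R) : Prop :=
  match p with
  | Vertex _ => False
  | Inner u v s _ _ => [/\ u = x, v = y & s = t] \/ [/\ u = y, v = x & s = 1 - t]
  end.

(** The lengths of the candidate shortest routes from [p] to [q]: those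
    passing through vertices, and, for interior points of a common edge, the
    segment of that edge between them. *)
Definition route_lengths (p q : realization) : set R :=
  [set r | exists u v, [/\ ends p u, ends q v &
                           r = u.2 + graph_dist u.1 v.1 + v.2]] `|`
  [set r | exists x y s t, [/\ lies_on p x y s, lies_on q x y t &
                               r = `|s - t|]].

Definition real_dist (p q : realization) : R := inf (route_lengths p q).

End Realization.

Arguments Vertex {R V adj} _.
Arguments graph_dist : clear implicits.
Arguments graph_dist R {V} adj x y.
Arguments realization : clear implicits.
Arguments realization R {V} adj.

(** * Groups and Cayley graphs *)

Definition symmetrized_generating_set (G : groupType) (A : set G) : Prop :=
  [/\ finite_set A,
      forall a, A a -> A (a^-1)%g &
      forall g : G, exists s : seq G,
        (forall a, a \in s -> A a) /\ g = (\prod_(a <- s) a)%g].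

(** Edges join [g] to [g * a] for [a] in [A].  If [1] belongs to [A] it
    contributes no loops. *)
Definition cayley (G : groupType) (A : set G) : rel G :=
  fun x y => (x != y) && ((x^-1 * y)%g \in A).

Definition cayley_graph (R : realType) (G : groupType) (A : set G) : Type :=
  realization R (cayley A).

Definition cayley_dist (R : realType) (G : groupType) (A : set G) :
    cayley_graph R A -> cayley_graph R A -> R :=
  @real_dist R G (cayley A).

Definition hyperbolic_wrt (R : realType) (G : groupType) (A : set G) : Prop :=
  gromov_hyperbolic (@cayley_dist R G A).

Definition quasiconvex (R : realType) (G : groupType) (A Q : set G) : Prop :=
  exists eps : R, 0 <= eps /\
    quasiconvex_with (@cayley_dist R G A) eps [set Vertex g | g in Q].

Definition subgroup (G : groupType) (H : set G) : Prop := group_closed (mem H).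

Definition infinite_index (G : groupType) (H : set G) : Prop :=
  infinite_set [set [set (g * h)%g | h in H] | g in [set: G]].

(** * Products [f_0 G_1 f_1 ... G_n f_n] and their finite unions *)

(** [members i] is [G_(i+1)] and [coeffs j] is [f_j]. *)
Record product_rep (G : groupType) := ProductRep {
  len : nat;
  members : 'I_len -> set G;
  coeffs : 'I_len.+1 -> G }.

Definition product_set (G : groupType) (P : product_rep G) : set G :=
  [set x | exists g : 'I_(len P) -> G,
     (forall i, members i (g i)) /\
     x = (coeffs (p := P) ord0 *
          \prod_(i < len P) (g i * coeffs (lift ord0 i)))%g].

Definition quasiconvex_product (R : realType) (G : groupType) (A : set G)
    (P : product_rep G) : Prop :=
  forall i : 'I_(len P), subgroup (members i) /\ quasiconvex R A (members i).

Definition union_set (G : groupType) (q : nat) (P : 'I_q -> product_rep G) :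
    set G :=
  \bigcup_(k in [set: 'I_q]) product_set (P k).

(** Membership refers to the chosen representation [P], not to the set it
    denotes. *)
Definition member_of_union (G : groupType) (q : nat) (P : 'I_q -> product_rep G)
    (H : set G) : Prop :=
  exists (k : 'I_q) (i : 'I_(len (P k))), H = members i.

Definition union_infinite_index (G : groupType) (q : nat)
    (P : 'I_q -> product_rep G) : Prop :=
  forall H : set G, member_of_union P H -> infinite_index H.

(* Main.v *)
Require Import Defs.
From HB Require Import structures.
From mathcomp Require Import all_boot all_order all_algebra.
From mathcomp Require Import all_classical all_reals.
From mathcomp Require Import zify lra.

(** The proof covers geodesics by cosets.  Let [d] be the word metric and say
    that [u] is nearly between [x] and [y] when [d x u + d u y] exceeds
    [d x y] by a bounded amount (twice the Gromov product of [x] and [y] at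
    [u]).

    If [g] belongs to a quasiconvex product with [n] members, then [1] and [g]
    are joined by a broken line whose long sides have both ends in a coset
    [x G_i] and whose other sides are short.  By hyperbolicity a point nearly
    between [1] and [g] is nearly between the ends of one of the sides, and by
    quasiconvexity it is then close to that coset.  So there are [n + 1]
    cosets ([{1}] is added for the first vertex) such that every point nearly
    between [1] and [g] is within a uniform constant [C] of one of them
    ([product_near]).  The trivial subgroup is quasiconvex and, as [G] is
    infinite, of infinite index; below it counts as one of the members.

    On the other hand, call the shadow of [u] the set of all [w] such that [u]
    is nearly between [1] and [w].  As [G] is infinite, the shadow of every
    point contains arbitrarily large balls: among the two ends of a long
    geodesic centred at [u], one points away from [1] ([exists_outward],
    [outward_ball]).  As the members have infinite index, such a ball is not
    contained in the neighbourhood of a coset of a member ([escape_coset]).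
    Hence there are points [u_0, u_1, u_2, ...] with decreasing shadows such
    that no coset of a member is [C]-close to two of them: between [u_i] and
    [u_(i+1)] one moves away from each of the finitely many cosets close to
    [u_i], and quasiconvexity forbids any return ([separated_chain]).

    If all elements of [G] were in the union, so would be [u_N] for a large
    [N]; the points [u_0, ..., u_(N-1)] are nearly between [1] and [u_N], so
    by the pigeonhole principle two of them are close to the same one of the
    [n + 1] cosets, a contradiction ([union_set_proper]).

    To apply this, the distance of the geometric realization is computed along
    a geodesic edge path, which yields a geodesic of the realization; this
    turns quasiconvexity in the Cayley graph into a statement on the
    integer-valued word metric. *)

Set Implicit Arguments.
Unset Strict Implicit.
Unset Printing Implicit Defensive.

Import Order.TTheory GRing.Theory Num.Theory.

Local Open Scope classical_set_scope.

(** * The path metric of a connected graph and its geometric realization *)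

Section Graph.
Context {R : realType} {V : eqType} (adj : rel V).
Hypothesis adj_sym : symmetric adj.
Hypothesis connected : forall x y, exists s, path adj x s /\ last x s = y.

Lemma path_length_exists x y :
  exists n, `[< exists s, [/\ path adj x s, last x s = y & size s = n] >].
Proof.
have [s [ps ls]] := connected x y.
by exists (size s); apply/asboolP; exists s.
Qed.

(** The combinatorial distance: the least length of an edge path. *)
Definition path_dist (x y : V) : nat := ex_minn (path_length_exists x y).

Lemma path_dist_attained x y :
  exists s, [/\ path adj x s, last x s = y & size s = path_dist x y].
Proof. by rewrite /path_dist; case: ex_minnP => n /asboolP. Qed.

Lemma path_dist_le x s : path adj x s -> (path_dist x (last x s) <= size s)%N.
Proof.
rewrite /path_dist; case: ex_minnP => n _ nmin ps; apply: nmin.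
by apply/asboolP; exists s.
Qed.

Lemma path_dist_refl x : path_dist x x = 0%N.
Proof. by apply/eqP; rewrite -leqn0; exact: (@path_dist_le x [::]). Qed.

Lemma path_dist_triangle x y z :
  (path_dist x z <= path_dist x y + path_dist y z)%N.
Proof.
have [s [ps <- <-]] := path_dist_attained x y.
have [s' [ps' <- <-]] := path_dist_attained (last x s) z.
by rewrite -size_cat -last_cat path_dist_le// cat_path ps.
Qed.

Lemma path_dist_sym_le x y : (path_dist y x <= path_dist x y)%N.
Proof.
have [s [ps <- <-]] := path_dist_attained x y.
have := @path_dist_le (last x s) (rev (belast x s)).
rewrite size_rev size_belast rev_path.
under eq_path => ? ? do rewrite adj_sym.
move=> /(_ ps); congr (path_dist _ _ <= _)%N.
by case: s {ps} => //= a s; rewrite rev_cons last_rcons.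
Qed.

Lemma path_dist_sym x y : path_dist x y = path_dist y x.
Proof. by apply/eqP; rewrite eqn_leq !path_dist_sym_le. Qed.

Lemma path_dist_adj x y : adj x y -> (path_dist x y <= 1)%N.
Proof. by move=> xy; apply: (@path_dist_le x [:: y]); rewrite /= xy. Qed.

Local Open Scope ring_scope.

Lemma graph_distE x y : graph_dist R adj x y = (path_dist x y)%:R.
Proof.
apply/eqP; rewrite eq_le; apply/andP; split.
  apply: ge_inf.
    by exists 0 => _ [s _ <-]; exact: ler0n.
  by have [s [ps ls ss]] := path_dist_attained x y; exists s => //; rewrite ss.
apply: lb_le_inf.
  have [s [ps ls ss]] := path_dist_attained x y.
  by exists (size s)%:R; exists s.
by move=> _ [s [ps <-] <-]; rewrite ler_nat path_dist_le.
Qed.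

Lemma real_dist_vertex x y :
  real_dist (Vertex x : realization R adj) (Vertex y) = (path_dist x y)%:R.
Proof.
rewrite /real_dist.
have -> : route_lengths (Vertex x : realization R adj) (Vertex y)
    = [set (path_dist x y)%:R]; last exact: inf1.
apply/seteqP; split=> [_ [[u [v [/= -> -> ->]]]|[? [? [? [? []]]]]]|_ ->] //=.
  by rewrite graph_distE add0r addr0.
by left; exists (x, 0), (y, 0); split; rewrite //= graph_distE add0r addr0.
Qed.

(** Here [p 0, ..., p L] are the successive vertices of a geodesic edge path;
    the values of [p] beyond [L] play no role. *)
Section Geodesic.
Context (p : nat -> V) (L : nat).
Hypothesis p_adj : forall i, (i < L)%N -> adj (p i) (p i.+1).
Hypothesis p_dist :
  forall i j, (i <= j <= L)%N -> path_dist (p i) (p j) = (j - i)%N.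

(** The point at distance [t] from [p 0] along the edge path, for [t] between
    [0] and [L]. It is a vertex when [t] is an integer, and otherwise lies
    inside an edge. *)
Definition path_point (t : R) : realization R adj :=
  let k := Num.truncn t in
  match @idP (adj (p k) (p k.+1)), @idP (0 < t - k%:R < 1) with
  | ReflectT pk, ReflectT tk => Inner pk tk
  | _, _ => Vertex (p k)
  end.

Lemma path_point_vertex k : path_point k%:R = Vertex (p k).
Proof.
rewrite /path_point natrK; case: {-}_ / idP => // ?.
by case: {-}_ / idP => // h; exfalso; rewrite subrr ltxx in h.
Qed.

Variant path_point_spec (t : R) : realization R adj -> Prop :=
| AtVertex k of (k <= L)%N & t = k%:R : path_point_spec t (Vertex (p k))
| InEdge k (pk : adj (p k) (p k.+1)) (tk : 0 < t - k%:R < 1) of (k < L)%N :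
    path_point_spec t (Inner pk tk).

Lemma path_pointP t : 0 <= t <= L%:R -> path_point_spec t (path_point t).
Proof.
move=> /andP[t0 tL]; have /andP[kt tk] := truncn_itv t0.
have [->|tNk] := eqVneq t (Num.truncn t)%:R.
  rewrite path_point_vertex; apply: AtVertex => //.
  by rewrite -(ler_nat R) (le_trans kt).
have kL : (Num.truncn t < L)%N.
  by rewrite -(ltr_nat R) (lt_le_trans _ tL)// lt_neqAle eq_sym tNk.
rewrite /path_point; case: {-}_ / idP => [pk|/(_ (p_adj kL))//].
case: {-}_ / idP => [tk'|[]]; first exact: InEdge.
rewrite subr_gt0 lt_neqAle eq_sym tNk kt/=.
by rewrite ltrBlDl -natr1 in tk *.
Qed.

Lemma p_distR i j : (i <= L)%N -> (j <= L)%N ->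
  (path_dist (p i) (p j))%:R = `|i%:R - j%:R| :> R.
Proof.
wlog ij : i j / (i <= j)%N.
  move=> h iL jL; have [ij|/ltnW ij] := leqP i j; first exact: h.
  by rewrite path_dist_sym distrC h.
move=> _ jL; rewrite p_dist ?ij// natrB// distrC ger0_norm//.
by rewrite subr_ge0 ler_nat.
Qed.

Lemma p_inj i j : (i <= L)%N -> (j <= L)%N -> p i = p j -> i = j.
Proof.
move=> iL jL E; have := p_distR iL jL; rewrite E path_dist_refl => /esym/eqP.
by rewrite normr_eq0 subr_eq0 eqr_nat => /eqP.
Qed.

(** The ends of the cell carrying a point of the path are vertices of the path,
    at the expected distance; with the triangle inequality on the line, this
    bounds below the length of every route through vertices. *)
Lemma path_point_ends t v : 0 <= t <= L%:R -> ends (path_point t) v ->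
  exists i, [/\ (i <= L)%N, v.1 = p i & v.2 = `|t - i%:R|].
Proof.
case/path_pointP => [k kL ->|k pk /andP[k0 k1] kL] /=.
  by move=> ->; exists k; rewrite subrr normr0.
case=> ->; first by exists k; split=> //=; [exact: ltnW|rewrite gtr0_norm].
exists k.+1; split=> //=; rewrite ltr0_norm -natr1; lra.
Qed.

Lemma path_point_lies_on s t x y a b : 0 <= s <= L%:R -> 0 <= t <= L%:R ->
  lies_on (path_point s) x y a -> lies_on (path_point t) x y b ->
  `|a - b| = `|s - t|.
Proof.
case/path_pointP => // k pk ? kL; case/path_pointP => // l pl ? lL /=.
(* An edge of a geodesic is traversed once only, and in one direction. *)
case=> -[xk yk sk]; case=> -[xl yl tl]; subst.
- have := p_inj (ltnW kL) (ltnW lL) (esym xl) => E; subst l.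
  by congr `| _ |; lra.
- have := p_inj (ltnW kL) lL (esym yl).
  have := p_inj kL (ltnW lL) (esym xl); lia.
- have := p_inj (ltnW kL) lL (esym yl).
  have := p_inj kL (ltnW lL) (esym xl); lia.
- have := p_inj (ltnW kL) (ltnW lL) (esym xl) => E; subst l.
  by rewrite distrC; congr `| _ |; lra.
Qed.

Lemma route_length_ge s t r : 0 <= s <= L%:R -> 0 <= t <= L%:R ->
  route_lengths (path_point s) (path_point t) r -> `|s - t| <= r.
Proof.
move=> sL tL [[u [v [/(path_point_ends sL)[i [iL -> ->]]]]]|].
  move=> /(path_point_ends tL)[j [jL -> ->]] ->.
  rewrite graph_distE (p_distR iL jL) (distrC t).
  apply: le_trans (ler_distD j%:R _ _) _; rewrite lerD2r.
  exact: ler_distD.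
by move=> [x [y [a [b [sx tx ->]]]]]; rewrite (path_point_lies_on sL tL sx tx).
Qed.

Lemma route_length_vertices (q q' : realization R adj) i j a b :
  (i <= j <= L)%N -> ends q (p i, a) -> ends q' (p j, b) ->
  route_lengths q q' (a + (j%:R - i%:R) + b).
Proof.
move=> ijL qi q'j; left; exists (p i, a), (p j, b); split=> //=.
by rewrite graph_distE p_dist// natrB//; case/andP: ijL.
Qed.

(** The arc of the path between two of its points is one of the routes. *)
Lemma route_length_le s t : 0 <= s -> s <= t -> t <= L%:R ->
  route_lengths (path_point s) (path_point t) (t - s).
Proof.
move=> s0 st tL.
have sL : 0 <= s <= L%:R by rewrite s0 (le_trans st).
have {}tL : 0 <= t <= L%:R by rewrite tL (le_trans s0).
case: (path_pointP sL) st => [k kL ->|k pk ks kL];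
  case: (path_pointP tL) => [l lL ->|l pl lt lL] st.
- have -> : l%:R - k%:R = 0 + (l%:R - k%:R) + 0 :> R by lra.
  by apply: route_length_vertices => //; rewrite lL -(ler_nat R) st.
- have -> : t - k%:R = 0 + (l%:R - k%:R) + (t - l%:R) :> R by lra.
  apply: route_length_vertices => //; last by left.
  by rewrite (ltnW lL) andbT -ltnS -(ltr_nat R) -natr1; lra.
- have -> : l%:R - s = (1 - (s - k%:R)) + (l%:R - k.+1%:R) + 0 :> R.
    by rewrite -natr1; lra.
  apply: route_length_vertices => //; last by right.
  by rewrite lL andbT -(ltr_nat R); lra.
have : (k <= l)%N by rewrite -ltnS -(ltr_nat R) -natr1; lra.
rewrite leq_eqVlt => /predU1P[E|kl].
  subst l; right; exists (p k), (p k.+1), (s - k%:R), (t - k%:R).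
  by split; [left|left|rewrite distrC ger0_norm; lra].
have -> : t - s = (1 - (s - k%:R)) + (l%:R - k.+1%:R) + (t - l%:R) :> R.
  by rewrite -natr1; lra.
by apply: route_length_vertices; [rewrite kl ltnW|right|left].
Qed.

Lemma route_lengths_sym (q q' : realization R adj) r :
  route_lengths q q' r -> route_lengths q' q r.
Proof.
case=> [[u [v [qu qv ->]]]|[x [y [a [b [qx qy ->]]]]]].
  left; exists v, u; split=> //.
  by rewrite !graph_distE (path_dist_sym u.1); lra.
by right; exists x, y, b, a; split=> //; rewrite distrC.
Qed.

Lemma real_dist_path_point s t : 0 <= s <= L%:R -> 0 <= t <= L%:R ->
  real_dist (path_point s) (path_point t) = `|s - t|.
Proof.
move=> sL tL.
have st : route_lengths (path_point s) (path_point t) `|s - t|.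
  have /andP[s0 sL'] := sL; have /andP[t0 tL'] := tL.
  have [h|/ltW h] := leP s t.
    by rewrite distrC ger0_norm ?subr_ge0//; exact: route_length_le.
  rewrite ger0_norm ?subr_ge0//; apply: route_lengths_sym.
  exact: route_length_le.
have lb : lbound (route_lengths (path_point s) (path_point t)) `|s - t|.
  by move=> r; exact: route_length_ge.
apply/eqP; rewrite eq_le /real_dist; apply/andP; split.
  by apply: ge_inf => //; exists `|s - t|.
by apply: lb_le_inf => //; exists `|s - t|.
Qed.

Lemma path_point_geodesic :
  geodesic (@real_dist R V adj) (Vertex (p 0)) (Vertex (p L)) L%:R path_point.
Proof.
split; [exact: ler0n|exact: (path_point_vertex 0)|exact: path_point_vertex|].
by move=> s t sL tL; rewrite real_dist_path_point// -in_itv.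
Qed.

End Geodesic.

(** A vertex that realizes equality in the triangle inequality lies on a
    geodesic edge path. *)
Lemma geodesic_through x z y :
  (path_dist x z + path_dist z y = path_dist x y)%N ->
  exists p : nat -> V,
    [/\ p 0 = x, p (path_dist x z) = z, p (path_dist x y) = y,
        forall i, (i < path_dist x y)%N -> adj (p i) (p i.+1) &
        forall i j, (i <= j <= path_dist x y)%N ->
          path_dist (p i) (p j) = (j - i)%N].
Proof.
move=> xzy; set L := path_dist x y.
have [s [ps ls ss]] := path_dist_attained x z.
have [s' [ps' ls' ss']] := path_dist_attained z y.
pose p i := nth x (x :: s ++ s') i.
have p0 : p 0 = x by [].
have pL : p L = y.
  rewrite /p /L -xzy -ss -ss' -size_cat.
  rewrite -[size _]/(size (x :: s ++ s')).-1.
  by rewrite nth_last /= last_cat ls ls'.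
have pz : p (path_dist x z) = z.
  rewrite /p -cat_cons nth_cat /= -ss ltnSn.
  by rewrite -[size s]/(size (x :: s)).-1 nth_last.
have padj i : (i < L)%N -> adj (p i) (p i.+1).
  move=> iL; have /(pathP x) : path adj x (s ++ s') by rewrite cat_path ps ls.
  by apply; rewrite size_cat ss ss' xzy.
have ple i k : (i + k <= L)%N -> (path_dist (p i) (p (i + k)%N) <= k)%N.
  elim: k => [|k IH] ikL; first by rewrite addn0 path_dist_refl.
  rewrite addnS in ikL *.
  apply: leq_trans (path_dist_triangle _ (p (i + k)%N) _) _.
  have := path_dist_adj (padj _ ikL); have := IH (ltnW ikL); lia.
(* The three pieces cut out by [i] and [j] have lengths at most [i], [j - i]
   and [L - j]; their sum is at least [L], so these are equalities. *)
exists p; split=> // i j /andP[ij jL].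
have := ple 0%N i; have := ple i (j - i)%N; have := ple j (L - j)%N.
rewrite add0n !subnKC// pL p0.
have := path_dist_triangle x (p i) y; have := path_dist_triangle (p i) (p j) y.
rewrite -/L; lia.
Qed.

(** Quasiconvexity in the realization, restricted to the vertices of geodesics.
    The infimum defining [set_dist] need not be attained a priori, hence the
    margin of [1] in the constant. *)
Lemma quasiconvex_discrete (eps : R) (Q : set V) :
  quasiconvex_with (@real_dist R V adj) eps [set Vertex v | v in Q] ->
  exists n : nat, forall x y z, Q x -> Q y ->
    (path_dist x z + path_dist z y = path_dist x y)%N ->
    exists2 v, Q v & (path_dist z v <= n)%N.
Proof.
move=> qc; exists (Num.truncn (eps + 1)) => x y z Qx Qy xzy.
have [p [p0 pz pL padj pdist]] := geodesic_through xzy.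
have := path_point_geodesic padj pdist; rewrite p0 pL => geo.
have Vx : [set (Vertex v : realization R adj) | v in Q] (Vertex x) by exists x.
have Vy : [set (Vertex v : realization R adj) | v in Q] (Vertex y) by exists y.
have /(qc _ _ Vx Vy _ _ geo) :
    ((path_dist x z)%:R : R) \in `[0, (path_dist x y)%:R].
  by rewrite in_itv /= ler0n ler_nat -xzy leq_addr.
rewrite path_point_vertex pz => h.
have eps_lt : eps < eps + 1 by rewrite ltrDl.
have /inf_lt[|_ [_ [v Qv <-] <-]] := le_lt_trans h eps_lt.
  by eexists; exists (Vertex x).
rewrite real_dist_vertex => /ltW vz; exists v => //.
by rewrite truncn_ge_nat// (le_trans _ vz).
Qed.

End Graph.

(** * Cosets in a group with a hyperbolic word metric *)

Section Subgroup.
Context {G : groupType} (H : set G) (sH : subgroup H).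

Lemma subgroup1 : H 1%g.
Proof. by have [/set_mem] := sH. Qed.

Lemma subgroupV x : H x -> H (x^-1)%g.
Proof. by move=> /mem_set Hx; apply/set_mem; exact: group_closedV sH _ Hx. Qed.

Lemma subgroupM x y : H x -> H y -> H (x * y)%g.
Proof.
move=> /mem_set Hx /mem_set Hy; apply/set_mem.
exact: group_closedM sH _ _ Hx Hy.
Qed.

End Subgroup.

Section NatMetric.
Context {G : groupType} (d : G -> G -> nat).
Local Open Scope nat_scope.

(** The properties of the word metric of a finitely generated group that are
    used below. The last one is Gromov's four-point condition; [e] is twice
    the usual hyperbolicity constant. *)
Record hyperbolic_word_metric (e : nat) : Prop := HyperbolicWordMetric {
  wm_refl : forall x, d x x = 0;
  wm_sym : forall x y, d x y = d y x;
  wm_triangle : forall x y z, d x z <= d x y + d y z;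
  wm_mull : forall g x y, d (g * x)%g (g * y)%g = d x y;
  wm_geodesic : forall x y n, n <= d x y ->
    exists2 z, d x z = n & d z y = d x y - n;
  wm_ball_finite : forall n, finite_set [set x | d 1%g x <= n];
  wm_four_points : forall x y z w,
    d x z + d y w <= maxn (d x y + d z w) (d y z + d x w) + e }.

(** The point [u] is between [x] and [y] up to an excess [k], which bounds twice
    the Gromov product of [x] and [y] at [u]. *)
Definition between (k : nat) (x u y : G) : Prop :=
  d x u + d u y <= d x y + k.

(** The point [u] is at distance at most [C] from the coset [x H]. *)
Definition near (C : nat) (x : G) (H : set G) (u : G) : Prop :=
  exists2 h, H h & d u (x * h)%g <= C.

(** The points between two elements of [H] with no excess are the vertices of
    the geodesics joining them, when [d] is a word metric; [near eps 1 H] is the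
    [eps]-neighbourhood of [H]. *)
Definition discrete_quasiconvex (H : set G) : Prop :=
  exists eps, forall p q z, H p -> H q -> between 0 p z q -> near eps 1%g H z.

Context (e : nat) (hd : hyperbolic_word_metric e).
Let dxx := wm_refl hd.
Let dC := wm_sym hd.
Let dtri := wm_triangle hd.
Let dmul := wm_mull hd.
Let d4 := wm_four_points hd.

Lemma near_mono C C' x H u : C <= C' -> near C x H u -> near C' x H u.
Proof. by move=> CC' [h Hh hC]; exists h => //; apply: leq_trans CC'. Qed.

Lemma dmulV g x y : d (g^-1 * x)%g y = d x (g * y)%g.
Proof. by rewrite -(dmul g) mulVKg. Qed.

Lemma dmulr x y : d x (x * y)%g = d 1%g y.
Proof. by rewrite -{1}(mulg1 x) dmul. Qed.

(** Quasiconvexity in a coarse form: a point nearly between two points close to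
    a coset is close to that coset, with a constant independent of the coset. *)
Lemma near_between H c k : discrete_quasiconvex H ->
  exists C, forall x p q u,
    near c x H p -> near c x H q -> between k p u q -> near C x H u.
Proof.
case=> eps qc; exists (eps + (k + 4 * c) + e + 1) => x p q u.
move=> [h1 H1 d1] [h2 H2 d2] b.
(* Translate by [x^-1], so that the coset becomes [H] itself. *)
pose v := (x^-1 * u)%g.
have vh h : d v h = d u (x * h)%g by rewrite dmulV.
have bv : d h1 v + d v h2 <= d h1 h2 + (k + 4 * c).
  have -> : d h1 h2 = d (x * h1)%g (x * h2)%g by rewrite dmul.
  rewrite (dC h1) !vh.
  move: b; rewrite /between => b.
  have := dtri u p (x * h1)%g; have := dtri u q (x * h2)%g.
  have := dtri p (x * h1)%g q; have := dtri (x * h1)%g (x * h2)%g q.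
  rewrite (dC (x * h2)%g q) (dC u p); lia.
(* The point [z] at distance [n] from [h1] on a geodesic from [h1] to [h2] is
   the one facing [v]; the half is rounded down, at a cost of at most [1]. *)
pose n := ((d h1 v + d h1 h2) - d v h2)./2.
have t1 := dtri h1 v h2; have t2 := dtri h1 h2 v; have t3 := dtri v h1 h2.
rewrite (dC h2 v) in t2; rewrite (dC v h1) in t3.
have nle : n <= d h1 h2 by rewrite /n; lia.
have [z z1 z2] := wm_geodesic hd nle.
have zb : between 0 h1 z h2 by rewrite /between; lia.
have [h Hh hz] := qc h1 h2 z H1 H2 zb.
exists h => //; rewrite -vh.
rewrite mul1g in hz.
have := dtri v z h.
have := d4 v h1 z h2; rewrite (dC v h1) /n in z1 z2 *; lia.
Qed.

(** The points seen from [1] through a neighbourhood of [u]. The excess [3 * e]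
    is large enough for shadows to be nested in [shadow_sub], where the
    excess of the inner base point is only [2 * e]. *)
Definition shadow (u : G) : set G := [set w | between (3 * e) 1%g u w].

Lemma shadow_refl u : shadow u u.
Proof. by rewrite /shadow /= /between dxx; lia. Qed.

Lemma shadow_sub u u' w : between (2 * e) 1%g u u' -> 3 * e < d u u' ->
  shadow u' w -> shadow u w.
Proof.
rewrite /shadow /= /between => b1 f b2.
have := d4 1%g u u' w; lia.
Qed.

Lemma shadow_between u u' w : shadow u u' -> 4 * e < d u u' ->
  shadow u' w -> between (4 * e) u u' w.
Proof.
rewrite /shadow /= /between => b1 f b2.
have := d4 1%g u w u'; rewrite (dC w u'); lia.
Qed.

Lemma between_split k x y z u : between k x u z ->
  between (k + e) x u y \/ between (k + e) y u z.
Proof.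
rewrite /between => b; have := d4 x y z u; rewrite (dC z u) (dC y u).
have [] := leqP (d x u + d u y) (d x y + (k + e)); first by left.
by right; lia.
Qed.

(** A point nearly between the ends of a broken line is nearly between the ends
    of one of its sides. *)
Lemma between_path k (p : nat -> G) u m : between k (p 0) u (p m.+1) ->
  exists2 i, i <= m & between (k + m * e) (p i) u (p i.+1).
Proof.
elim: m k => [|m IH] k b; first by exists 0 => //; rewrite mul0n addn0.
have [/IH[i im bi]|bm] := between_split (p m.+1) b.
  by exists i; [exact: leqW|rewrite mulSn addnA].
by exists m.+1 => //; move: bm; rewrite /between mulSn; lia.
Qed.

Lemma between_endpoint k p q u F :
  between k p u q -> d p q <= F -> d u p <= k + F.
Proof. by rewrite /between (dC p u) => b f; lia. Qed.

Hypothesis infG : infinite_set [set: G].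

Lemma exists_long n : exists g : G, d 1%g g = n.
Proof.
have [g ng] : exists g, n <= d 1%g g.
  apply: contrapT => /forallNP h; apply: infG.
  apply: sub_finite_set (wm_ball_finite hd n) => x _ /=.
  by have /negP := h x; rewrite -ltnNge => /ltnW.
by have [z] := wm_geodesic hd ng; exists z.
Qed.

(** One of the two ends of a geodesic of length [2 L] centred at [u] points away
    from [1]. *)
Lemma exists_outward u L : exists2 a, d u a = L & between e 1%g u a.
Proof.
have [g gL] := exists_long (L + L).
have [z z1 z2] :=
  wm_geodesic hd (leq_trans (leq_addr L L) (eq_leq (esym gL))).
(* Translate the geodesic from [1] to [g] so that its midpoint [z] goes to
   [u]. *)
pose a := (u * z^-1)%g; pose b := (a * g)%g.
have az : (a * z)%g = u by rewrite mulgVK.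
have ua : d u a = L by rewrite -az dC dmulr.
have ub : d u b = L by rewrite -az dmul z2; lia.
have ab : d a b = L + L by rewrite dmulr.
have := d4 a 1%g b u; rewrite (dC a 1%g) (dC b u) (dC a u) ua ub ab => h.
have [ha|ha] := leqP (d 1%g u + L) (d 1%g a + e).
  by exists a => //; rewrite /between ua.
by exists b => //; rewrite /between ub; lia.
Qed.

Lemma outward_ball u a h R : between e 1%g u a -> R + e < d u a -> d a h <= R ->
  between (2 * e) 1%g u h.
Proof.
rewrite /between => b f r; have := d4 1%g h a u; have := dtri u h a.
rewrite (dC h a) (dC h u) (dC a u); lia.
Qed.

(** A group is not a bounded neighbourhood of a subgroup of infinite index. *)
Lemma infinite_index_thin H C : subgroup H -> infinite_index H ->
  exists z, forall h b, H h -> d 1%g b <= C -> z <> (h * b)%g.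
Proof.
move=> sH iH; apply: contrapT => /forallNP allHB; apply: iH.
(* Inverting [G = H B] gives [G = B^-1 H], with [B] a finite ball. *)
apply: sub_finite_set (finite_image (fun b => [set (b^-1 * h)%g | h in H])
                                    (wm_ball_finite hd C)).
move=> _ [g _ <-] /=.
have /existsNP[h /existsNP[b /not_implyP[Hh /not_implyP[bC /contrapT gE]]]] :=
  allHB (g^-1)%g.
exists b => //; have {gE} -> : g = (b^-1 * h^-1)%g by rewrite -invgM -gE invgK.
apply/seteqP; split=> _ [k Hk <-].
  exists (h * k)%g; first exact: subgroupM.
  by rewrite mulgA mulgVK.
exists (h^-1 * k)%g; last by rewrite mulgA.
exact: subgroupM (subgroupV sH Hh) Hk.
Qed.

(** Some point of the shadow of [u] is far both from [u] and from a given
    coset. The excess [2 * e] is the one required by [shadow_sub]. *)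
Lemma escape_coset H u x C M : subgroup H -> infinite_index H ->
  exists u', [/\ between (2 * e) 1%g u u', M < d u u' & ~ near C x H u'].
Proof.
move=> sH /(infinite_index_thin C sH)[z zHB].
(* Within [R] of every point of the [C]-neighbourhood of [x H], there is a
   point outside: the translate of [z] by a nearby element of [x H]. *)
pose R := C + d 1%g z.
have [a ua b] := exists_outward u (R + R + e + M).+1.
have ball h : d a h <= R -> between (2 * e) 1%g u h /\ M < d u h.
  move=> ah; split; first by apply: outward_ball b _ ah; lia.
  by have := dtri u h a; rewrite (dC h a); lia.
have [[h Hh ah]|na] := pselect (near C x H a); last first.
  by exists a; have [|b1 b2] := ball a; [rewrite dxx|].
have [|b1 b2] := ball (x * h * z)%g.
  by apply: leq_trans (dtri _ (x * h)%g _) _; rewrite dmulr leq_add2r.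
exists (x * h * z)%g; split=> // -[h' Hh' hC].
apply: (zHB (h^-1 * h')%g ((x * h')^-1 * (x * h * z))%g).
- exact: subgroupM (subgroupV sH Hh) Hh'.
- by rewrite dC dmulV mulg1.
- by rewrite invgM -!mulgA mulKg mulVKg mulKg.
Qed.

Lemma near_coset C x H u h : subgroup H -> H h ->
  near C (x * h)%g H u <-> near C x H u.
Proof.
move=> sH Hh; split=> -[k Hk uk].
  by exists (h * k)%g; [exact: subgroupM|rewrite mulgA].
exists (h^-1 * k)%g; first exact: subgroupM (subgroupV sH Hh) Hk.
by rewrite -mulgA mulVKg.
Qed.

(** A finite family of quasiconvex subgroups of infinite index. *)
Section Family.
Context (I : finType) (H : I -> set G).
Hypothesis sH : forall i, subgroup (H i).
Hypothesis iH : forall i, infinite_index (H i).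
Hypothesis qH : forall i, discrete_quasiconvex (H i).

(** A pair [(i, x)] stands for the coset [x H_i]. *)
Lemma escape_cosets C (l : seq (I * G)) u :
  exists2 u', shadow u' `<=` shadow u &
    forall p w, p \in l -> shadow u' w ->
      near C p.2 (H p.1) u -> ~ near C p.2 (H p.1) w.
Proof.
elim: l => [|[i x] l [v vu vl]]; first by exists u.
have [C' hC'] := near_between C (4 * e) (qH i).
have [u1 [b f nu1]] := escape_coset v x C' (7 * e + d u v) (sH i) (@iH i).
have u1v : shadow u1 `<=` shadow v by move=> w; apply: shadow_sub b _; lia.
(* If [u] and [w] were close to the coset, so would be [u1], which is nearly
   between them. *)
exists u1 => [w /u1v /vu //|p w]; rewrite inE => /predU1P[->|pl] u1w /=.
  move=> nu nw; apply: nu1; apply: hC' nu nw _.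
  apply: shadow_between u1w; first exact/vu/u1v/shadow_refl.
  by have := dtri v u u1; rewrite (dC v u); lia.
exact/vl/u1v.
Qed.

(** Moving past all cosets close to [u] at once: only finitely many are, as each
    has a representative in a ball centred at [u]. *)
Lemma escape_all_cosets C u :
  exists2 u', shadow u' `<=` shadow u &
    forall i x w, shadow u' w -> near C x (H i) u -> ~ near C x (H i) w.
Proof.
have /finite_seqP[s sE] : finite_set [set x | d u x <= C].
  have fB := finite_image (fun b => (u * b)%g) (wm_ball_finite hd C).
  apply: sub_finite_set fB.
  move=> x /= ux; exists (u^-1 * x)%g; last by rewrite mulVKg.
  by rewrite /= dC dmulV mulg1 dC.
have [u' u'u hl] :=
  escape_cosets C [seq (i, x) | i <- enum I, x <- s] u.
exists u' => // i x w u'w nu nw.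
have [h Hh uh] := nu.
apply: (hl (i, x * h)%g w _ u'w) => /=; [|exact/near_coset..].
apply: allpairs_f; first by rewrite mem_enum.
by have : [set` s] (x * h)%g by rewrite -sE.
Qed.

(** Iterating from [1] gives nested shadows; as [u b] belongs to the shadow of
    [u a.+1] for [a < b], no coset is close to both [u a] and [u b]. *)
Lemma separated_chain C : exists u : nat -> G,
  (forall i j, i <= j -> shadow (u j) `<=` shadow (u i)) /\
  (forall a b i x, a < b -> near C x (H i) (u a) -> ~ near C x (H i) (u b)).
Proof.
have /choice[f hf] : forall u, exists u', shadow u' `<=` shadow u /\
    forall i x w, shadow u' w -> near C x (H i) u -> ~ near C x (H i) w.
  by move=> u; have [u' ? ?] := escape_all_cosets C u; exists u'.
pose u n := iter n f 1%g.
have mono i j : i <= j -> shadow (u j) `<=` shadow (u i).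
  move=> /subnK <-; elim: (j - i) => // n IH w /= ww.
  by apply: IH; have [h _] := hf (u (n + i)); exact: h.
exists u; split=> // a b i x ab.
by have [_] := hf (u a); apply; apply: (mono _ _ ab); exact: shadow_refl.
Qed.
End Family.

(** The points nearly between [1] and an element of a product are covered by the
    neighbourhoods of [1] and of one coset of each member; the constant does
    not depend on the element. *)
Lemma product_near (P : product_rep G) :
  (forall i, discrete_quasiconvex (members (p := P) i)) ->
  (forall i, subgroup (members (p := P) i)) ->
  exists C, forall g, product_set P g -> exists x : 'I_(len P) -> G,
    forall u, shadow u g ->
      d u 1%g <= C \/ exists i, near C (x i) (members i) u.
Proof.
move=> qP sP; pose n := len P; pose K := 3 * e + n * e + e.
have /choice[c hc] : forall i, exists C, forall x p q u,
    near 0 x (members (p := P) i) p -> near 0 x (members i) q ->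
    between K p u q -> near C x (members i) u.
  by move=> i; exact: near_between.
pose f i := coeffs (p := P) i.
pose C := K + \max_i d 1%g (f i) + \max_i c i.
exists C => _ [g [gP ->]].
(* [Q k] is the partial product of the first [k] factors [g_i f_(i+1)], preceded
   by [f_0]; the factors are extended by [1] to all natural indices. *)
pose F j := if insub j is Some i then (g i * f (lift ord0 i))%g else 1%g.
pose Q k := (f ord0 * \prod_(j < k) F j)%g.
have QS (i : 'I_n) : Q i.+1 = (Q i * g i * f (lift ord0 i))%g.
  by rewrite /Q big_ord_recr /= {2}/F valK !mulgA.
have Qn : Q n = (f ord0 * \prod_(i < n) (g i * f (lift ord0 i)))%g.
  by rewrite /Q; congr (_ * _)%g; apply: eq_bigr => i _; rewrite /F valK.
exists (fun i => Q i) => u; rewrite -Qn => ug.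
(* The broken line [1, Q 0, ..., Q n]; its sides after the first are cut
   further, at [Q i * g i]. *)
pose p k := if k is j.+1 then Q j else 1%g.
have fC i : d 1%g (f i) <= \max_i d 1%g (f i).
  exact: (leq_bigmax (F := fun i => d 1%g (f i))).
have [[_|j jn]] := between_path (p := p) (m := n) ug.
  have Q0 : Q 0 = f ord0 by rewrite /Q big_ord0 mulg1.
  rewrite /p Q0 => /between_endpoint/(_ (fC _)) h; left.
  by apply: leq_trans h _; rewrite /C /K; lia.
pose i := Ordinal jn; have -> : p j.+2 = Q i.+1 by [].
have -> : p j.+1 = Q i by [].
rewrite QS => b; right; exists i.
have [b1|b2] := between_split (Q i * g i)%g b.
  apply: near_mono (hc i (Q i) (Q i) (Q i * g i)%g u _ _ b1).
  - have := leq_bigmax (F := c) i; rewrite /C; lia.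
  - exists 1%g; first exact: subgroup1.
    by rewrite mulg1 dxx.
  - by exists (g i); rewrite ?dxx.
exists (g i) => //; have := between_endpoint b2 (F := \max_i d 1%g (f i)).
rewrite dmulr => /(_ (fC _)) h.
by apply: leq_trans h _; exact: leq_addr.
Qed.

Lemma trivial_subgroup : subgroup [set 1%g : G].
Proof.
by split=> [|x y /set_mem -> /set_mem ->]; apply/mem_set; rewrite //= divg1.
Qed.

Lemma trivial_infinite_index : infinite_index [set 1%g : G].
Proof.
move=> fin; apply: infG.
pose f (X : set G) := xget 1%g X.
apply: sub_finite_set (finite_image f fin) => x _.
exists [set (x * h)%g | h in [set 1%g]]; first by exists x.
rewrite /f image_set1 mulg1.
by case: xgetP => [? _ ->|/(_ x) []].
Qed.

Lemma trivial_quasiconvex : discrete_quasiconvex [set 1%g : G].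
Proof.
exists 0 => p q z -> ->; rewrite /between dxx => h.
by exists 1%g => //; rewrite mulg1 dC; lia.
Qed.

(** The members, together with the trivial subgroup, form the family to which
    [separated_chain] is applied. *)
Theorem union_set_proper q (P : 'I_q -> product_rep G) :
  (forall k i, subgroup (members (p := P k) i)) ->
  (forall k i, infinite_index (members (p := P k) i)) ->
  (forall k i, discrete_quasiconvex (members (p := P k) i)) ->
  union_set P `<` [set: G].
Proof.
move=> sP iP qP; split=> // allU.
pose J := option {k : 'I_q & 'I_(len (P k))}.
pose H (i : J) := if i is Some t then members (tagged t) else [set 1%g].
have /choice[c hc] := fun k => product_near (@qP k) (@sP k).
pose C := \max_k c k.
have cC k : c k <= C by exact: leq_bigmax.
have [||i|u [mono sep]] := @separated_chain J H _ _ _ C.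
- by case=> [[k i]|]; [exact: sP|exact: trivial_subgroup].
- by case=> [[k i]|]; [exact: iP|exact: trivial_infinite_index].
- by case: i => [[k i]|]; [exact: qP|exact: trivial_quasiconvex].
(* More points than the [len (P k) + 1] cosets available for any [k]. *)
pose N := (\max_k len (P k)).+2.
have [k _ /hc[x hx]] := allU (u N) I.
pose emb (i : option 'I_(len (P k))) : J :=
  if i is Some j then Some (Tagged (fun k => 'I_(len (P k))) j) else None.
pose y (i : option 'I_(len (P k))) := if i is Some j then x j else 1%g.
have /choice[phi hphi] :
    forall a : 'I_N, exists i, near C (y i) (H (emb i)) (u a).
  move=> a; have /hx[ua|[i ui]] : shadow (u a) (u N).
  - exact: (mono _ _ (ltnW (ltn_ord a))) (shadow_refl _).
  - exists None; exists 1%g => //=; rewrite mulg1; exact: leq_trans (cC k).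
  - by exists (Some i); exact: near_mono (cC k) _.
have /injectivePn[a [b ab phiE]] : ~~ injectiveb phi.
  apply/negP => /injectiveP/leq_card; rewrite card_option !card_ord.
  by have := leq_bigmax (F := fun k => len (P k)) k; rewrite /N; lia.
have separated (i j : 'I_N) : i < j -> phi i <> phi j.
  move=> ij E; apply: (sep i j (emb (phi i)) (y (phi i)) ij (hphi i)).
  by rewrite E.
case: (ltngtP a b) => [/separated/(_ phiE)//|/separated/(_ (esym phiE))//|E].
by rewrite (val_inj E) eqxx in ab.
Qed.

End NatMetric.

(** * The word metric of a hyperbolic group *)

Section Cayley.
Context {R : realType} {G : groupType} (A : set G).
Hypothesis hA : symmetrized_generating_set A.

Lemma cayley_sym : symmetric (cayley A).
Proof.
have [_ AV _] := hA; move=> x y; rewrite /cayley eq_sym; congr (_ && _).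
by apply/idP/idP => /set_mem/AV/mem_set; rewrite invgM invgK.
Qed.

Lemma cayley_mull g x y : cayley A (g * x)%g (g * y)%g = cayley A x y.
Proof. by rewrite /cayley invgM -mulgA mulKg (inj_eq (mulgI g)). Qed.

Lemma cayley_connected x y : exists s, path (cayley A) x s /\ last x s = y.
Proof.
have [_ _ gen] := hA; have [w [wA wE]] := gen (x^-1 * y)%g.
have {wE} -> : y = (x * \prod_(a <- w) a)%g by rewrite -wE mulVKg.
elim: w x wA => [|a w IH] x wA; first by exists [::]; rewrite big_nil mulg1.
have [|s [ps ls]] := IH (x * a)%g.
  by move=> b bw; apply: wA; rewrite inE bw orbT.
have aA : a \in A by apply/mem_set/wA; rewrite mem_head.
rewrite big_cons mulgA.
(* The Cayley graph has no loops, so a trivial letter is skipped. *)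
have [xa|xa] := eqVneq x (x * a)%g.
  by exists s; rewrite [in path _ _ _]xa [in last _ _]xa.
by exists ((x * a)%g :: s); split=> //=; rewrite ps /cayley xa mulKg aA.
Qed.

(** The word metric, as the combinatorial distance of the Cayley graph. *)
Definition word_dist := path_dist cayley_connected.

Lemma word_dist_mull_le g x y :
  (word_dist (g * x)%g (g * y)%g <= word_dist x y)%N.
Proof.
have [s [ps ls ss]] := path_dist_attained cayley_connected x y.
rewrite /word_dist -ss -ls -(last_map ( *%g g)) -(size_map ( *%g g)).
apply: path_dist_le; rewrite path_map.
by apply: sub_path ps => u v /=; rewrite cayley_mull.
Qed.

Lemma word_dist_mull g x y : word_dist (g * x)%g (g * y)%g = word_dist x y.
Proof.
apply/eqP; rewrite eqn_leq word_dist_mull_le/=.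
by have := word_dist_mull_le g^-1 (g * x)%g (g * y)%g; rewrite !mulKg.
Qed.

Lemma word_dist_interpolate x y n : (n <= word_dist x y)%N ->
  exists2 z, word_dist x z = n & word_dist z y = (word_dist x y - n)%N.
Proof.
have [|p [p0 _ py _ pdist]] := @geodesic_through _ _ cayley_connected x x y.
  by rewrite path_dist_refl.
move=> nle; exists (p n).
  by rewrite -p0 [LHS]pdist ?subn0.
by rewrite -[in LHS]py [LHS]pdist ?nle/=.
Qed.

Lemma word_ball_finite n : finite_set [set x | (word_dist 1%g x <= n)%N].
Proof.
have [fA _ _] := hA.
elim: n => [|n IH].
  apply: sub_finite_set (finite_set1 1%g) => x /=; rewrite leqn0 => /eqP x0.
  have [s [_ ls ss]] := path_dist_attained cayley_connected 1%g x.
  by rewrite -ls (size0nil (etrans ss x0)).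
have fin := finite_image2 (fun x a => (x * a)%g) IH fA.
have finU := conj IH fin; rewrite -finite_setU in finU.
apply: sub_finite_set finU => x.
rewrite /= leq_eqVlt ltnS => /predU1P[xn|]; last by left.
have [z zn zx] :=
  word_dist_interpolate (leq_trans (leqnSn n) (eq_leq (esym xn))).
rewrite xn subSnn in zx; right.
exists z; first by rewrite /= zn.
exists (z^-1 * x)%g; last by rewrite mulVKg.
have [s [ps ls ss]] := path_dist_attained cayley_connected z x.
have {ss} s1 : size s = 1%N := etrans ss zx.
case: s s1 ps ls => [//|y [|//]] _ /=.
by rewrite andbT => /andP[_ /set_mem zA] <-.
Qed.

Lemma cayley_dist_vertex x y :
  cayley_dist (Vertex x : cayley_graph R A) (Vertex y) = (word_dist x y)%:R%R.
Proof. exact: real_dist_vertex. Qed.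

Lemma hyperbolic_word_dist : hyperbolic_wrt R A ->
  exists e, hyperbolic_word_metric word_dist e.
Proof.
move=> [delta [delta0 hyp]].
exists (Num.truncn (2 * delta)).+1; split.
- exact: path_dist_refl.
- exact: path_dist_sym cayley_sym _.
- exact: path_dist_triangle.
- exact: word_dist_mull.
- exact: word_dist_interpolate.
- exact: word_ball_finite.
move=> x y z w.
have := hyp (Vertex w) (Vertex x) (Vertex y) (Vertex z).
rewrite /gromov_product !cayley_dist_vertex.
have := truncnS_gt (2 * delta)%R; set D := (Num.truncn _).+1 => dD.
have le_max a b m : (a <= b + D -> b <= m -> a <= m + D)%N.
  by move=> ab bm; apply: leq_trans ab _; rewrite leq_add2r.
rewrite lerBlDr ge_min => /orP[] h.
  by apply: le_max (leq_maxl _ _); rewrite -(ler_nat R) !natrD; lra.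
by apply: le_max (leq_maxr _ _); rewrite -(ler_nat R) !natrD; lra.
Qed.

Lemma quasiconvex_word_dist Q :
  quasiconvex R A Q -> discrete_quasiconvex word_dist Q.
Proof.
move=> [eps [_ /(quasiconvex_discrete cayley_sym cayley_connected)[n qc]]].
exists n => x y z Qx Qy; rewrite /between addn0 => xzy.
have [||| v Qv zv] := qc x y z => //.
  by apply/eqP; rewrite eqn_leq xzy; exact: path_dist_triangle.
by exists v; rewrite ?mul1g.
Qed.

End Cayley.

Theorem corollary1 (R : realType) (G : groupType) (A : set G)
    (hA : symmetrized_generating_set A)
    (hG : hyperbolic_wrt R A)
    (hinf : infinite_set [set: G])
    (q : nat) (P : 'I_q -> product_rep G)
    (hqc : forall k : 'I_q, quasiconvex_product R A (P k))
    (hidx : union_infinite_index P) :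
  union_set P `<` [set: G].
Proof.
have [e he] := hyperbolic_word_dist hA hG.
apply: (union_set_proper he hinf) => k i.
- by have [] := hqc k i.
- by apply: hidx; exists k, i.
- by have [_ /(quasiconvex_word_dist hA)] := hqc k i.
Qed.
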